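(* Let $T$ be a positive theory with the Joint Continuation Property. If $T$ is $\mathsf{NIP}$, then its hyperimaginary extension $T^{\mathrm{heq}}$ is also $\mathsf{NIP}$.
   Context: Positive logic: a positive formula is one built from atomic formulas (including equalities) using $\wedge,\vee,\top,\bot,\exists$. An h-inductive sentence is $\forall x\,(\varphi(x)\to\psi(x))$ with $\varphi,\psi$ positive; a positive theory is a consistent set of h-inductive sentences. A homomorphism is a map preserving positive formulas; an immersion also reflects them. A model of $T$ is pec if every homomorphism from it to a model of $T$ is an immersion. $T$ has the Joint Continuation Property if any two models of $T$ admit homomorphisms into a common model of $T$. All definitions apply to multi-sorted languages. We work in a monster model $\mathfrak U$ of $T$: for a sufficiently large cardinal $\bar\kappa$ (''small'' means of size $<\bar\kappa$), $\mathfrak U$ is a pec model such that every partial immersion $\mathfrak U\to\mathfrak U$ with small domain extends to an automorphism, and every small finitely satisfiable set of positive formulas over $\mathfrak U$ is satisfiable in $\mathfrak U$. A positive formula $\varphi(x;y)$ ($x,y$ finite tuples of variables) has $\mathsf{IP}$ modulo $T$ if there are a positive $\psi(x;y)$ with $T\models\forall x,y\,\neg(\varphi\wedge\psi)$, a model $A\models T$, and tuples $(a_i)_{i\in\omega}$, $(b_W)_{W\subseteq\omega}$ from $A$ with $A\models\varphi(a_i;b_W)$ for $i\in W$ and $A\models\psi(a_i;b_W)$ for $i\notin W$; otherwise it is $\mathsf{NIP}$. A theory is $\mathsf{NIP}$ if every positive formula is. Hyperimaginary extension: let $\mathcal E$ be a set of partial types $E(x,x')$ over $\emptyset$ (sets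 of positive formulas, in possibly infinite small tuples of variables) each defining an equivalence relation on $\mathfrak U^{|x|}$. Expand the language by a sort $S_E$ for each $E\in\mathcal E$, interpreted as the set of classes $[a]_E$, the original (home) sort being identified with its quotient by equality; and for each positive formula $\varphi(x_1,\dots,x_n)$ of the original language and $E_1,\dots,E_n\in\mathcal E$ (of matching tuples of variables) add a relation symbol $R_{\varphi}$ on $S_{E_1}\times\dots\times S_{E_n}$, interpreted by: $R_\varphi([a_1],\dots,[a_n])$ iff there are $a_i'$ with $[a_i']=[a_i]$ for all $i$ and $\mathfrak U\models\varphi(a_1',\dots,a_n')$. Let $\mathfrak U^{\mathrm{heq}}$ be the resulting structure; $T^{\mathrm{heq}}$ is the positive theory of $\mathfrak U^{\mathrm{heq}}$, i.e. the set of h-inductive sentences true in it. (It has $\mathfrak U^{\mathrm{heq}}$ as a monster model.) *)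

(* Defs.v *)
(* Many-sorted positive logic, over the classical layer of MathComp-Analysis. *)
From mathcomp Require Import all_boot.
From mathcomp Require Import boolp classical_sets functions cardinality.

Set Implicit Arguments.
Unset Strict Implicit.
Unset Printing Implicit Defensive.

Local Open Scope classical_set_scope.
Local Open Scope card_scope.

Record language := Language {
  sort : Type;
  fsym : Type;
  farity : fsym -> nat;
  fdom : forall f, 'I_(farity f) -> sort;
  fcod : fsym -> sort;
  rsym : Type;
  rarity : rsym -> nat;
  rdom : forall r, 'I_(rarity r) -> sort
}.
Arguments fdom {l} f _.
Arguments rdom {l} r _.

(* A tuple of variables, possibly infinite, is a family [x : V -> sort L]
   giving the sort of each variable. Finite tuples are families over 'I_n. *)
Section Syntax.
Variable L : language.

Definition ctx_cat (V W : Type) (x : V -> sort L) (y : W -> sort L) :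
    V + W -> sort L :=
  fun v => match v with inl v => x v | inr w => y w end.

Definition ctx_ext (V : Type) (x : V -> sort L) (s : sort L) :
    option V -> sort L :=
  fun v => match v with Some v => x v | None => s end.

Inductive term (V : Type) (x : V -> sort L) : sort L -> Type :=
| Var (v : V) : term x (x v)
| App (f : fsym L) (t : forall i, term x (fdom f i)) : term x (fcod f).

Inductive pformula (V : Type) (x : V -> sort L) : Type :=
| PTop
| PBot
| PEq (s : sort L) (t u : term x s)
| PRel (r : rsym L) (t : forall i, term x (rdom r i))
| PAnd (phi psi : pformula x)
| POr (phi psi : pformula x)
| PEx (s : sort L) (phi : pformula (ctx_ext x s)).

Record hinductive := HInductive {
  hi_len : nat;
  hi_vars : 'I_hi_len -> sort L;
  hi_prem : pformula hi_vars;
  hi_concl : pformula hi_vars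
}.

Definition theory := set hinductive.

End Syntax.

(* Sorts are allowed to be empty; nonemptiness of a sort s can be imposed by
   the h-inductive axiom [PTop -> PEx s PTop]. *)
Record structure (L : language) := Structure {
  carrier :> sort L -> Type;
  fun_int : forall f : fsym L,
    (forall i, carrier (fdom f i)) -> carrier (fcod f);
  rel_int : forall r : rsym L, (forall i, carrier (rdom r i)) -> Prop
}.
Arguments fun_int {L} s f _.
Arguments rel_int {L} s r _.

Section Semantics.
Variable L : language.
Implicit Types (A B : structure L) (T : theory L).

Definition assignment A (V : Type) (x : V -> sort L) := forall v, A (x v).

Definition assign_cat A (V W : Type) (x : V -> sort L) (y : W -> sort L)
    (a : assignment A x) (b : assignment A y) : assignment A (ctx_cat x y) :=
  fun v => match v with inl v => a v | inr w => b w end.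

Definition assign_ext A (V : Type) (x : V -> sort L) (s : sort L)
    (a : assignment A x) (c : A s) : assignment A (ctx_ext x s) :=
  fun v => match v with Some v => a v | None => c end.

Fixpoint eval A (V : Type) (x : V -> sort L) (a : assignment A x)
    (s : sort L) (t : term x s) : A s :=
  match t with
  | Var v => a v
  | App f t => fun_int A f (fun i => eval a (t i))
  end.

Fixpoint sat A (V : Type) (x : V -> sort L) (a : assignment A x)
    (phi : pformula x) : Prop :=
  match phi with
  | PTop => True
  | PBot => False
  | PEq _ t u => eval a t = eval a u
  | PRel r t => rel_int A r (fun i => eval a (t i))
  | PAnd phi psi => sat a phi /\ sat a psi
  | POr phi psi => sat a phi \/ sat a psi
  | PEx s phi => exists c : A s, sat (assign_ext a c) phi
  end.

Definition holds A (theta : hinductive L) : Prop :=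
  forall a : assignment A (@hi_vars _ theta),
    sat a (hi_prem theta) -> sat a (hi_concl theta).

Definition models A T : Prop := forall theta, T theta -> holds A theta.

Definition positive_theory T : Prop := exists A, models A T.

(* The set of h-inductive sentences true in A. *)
Definition theory_of A : theory L := [set theta | holds A theta].

Definition sorted_map A B := forall s, A s -> B s.

Definition map_assign A B (h : sorted_map A B) (V : Type) (x : V -> sort L)
    (a : assignment A x) : assignment B x :=
  fun v => h _ (a v).

Definition homomorphism A B (h : sorted_map A B) : Prop :=
  forall n (x : 'I_n -> sort L) (phi : pformula x) (a : assignment A x),
    sat a phi -> sat (map_assign h a) phi.

Definition immersion A B (h : sorted_map A B) : Prop :=
  forall n (x : 'I_n -> sort L) (phi : pformula x) (a : assignment A x),
    sat a phi <-> sat (map_assign h a) phi.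

Definition automorphism A (h : sorted_map A A) : Prop :=
  homomorphism h /\
  exists g : sorted_map A A, homomorphism g /\
    forall s (c : A s), g s (h s c) = c /\ h s (g s c) = c.

Definition pec T A : Prop :=
  models A T /\
  forall B (h : sorted_map A B), models B T -> homomorphism h -> immersion h.

Definition joint_continuation T : Prop :=
  forall A B, models A T -> models B T ->
    exists C, models C T /\
      (exists f : sorted_map A C, homomorphism f) /\
      (exists g : sorted_map B C, homomorphism g).

End Semantics.

(* Cardinals are represented by types: [small K X] says that |X| < |K|. *)
Definition small (K X : Type) (S : set X) : Prop :=
  (S #<= [set: K]) /\ ~ ([set: K] #<= S).
Arguments small K {X} S.

Section Monster.
Variables (L : language) (K : Type).

(* |K| > |L| + aleph_0. *)
Definition sufficiently_large : Prop :=
  small K [set: nat + sort L + fsym L + rsym L].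

Definition elements (A : structure L) := {s : sort L & A s}.

(* A partial map from A to A with domain D is given by a total map, of which
   only the values on D are used. *)
Definition partial_immersion (A : structure L) (D : set (elements A))
    (f : sorted_map A A) : Prop :=
  forall n (x : 'I_n -> sort L) (phi : pformula x) (a : assignment A x),
    (forall i, D (existT _ _ (a i))) ->
    (sat a phi <-> sat (map_assign f a) phi).

Definition homogeneous (A : structure L) : Prop :=
  forall (D : set (elements A)) (f : sorted_map A A),
    small K D -> partial_immersion D f ->
    exists g : sorted_map A A, automorphism g /\
      forall s (c : A s), D (existT _ s c) -> g s c = f s c.

(* Formulas with parameters in A, in the variables x, are formulas in the
   concatenation of x with one variable for each element of A. *)
Definition param_ctx (A : structure L) : elements A -> sort L :=
  fun p => projT1 p.

Definition param_assign (A : structure L) : assignment A (@param_ctx A) :=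
  fun p => projT2 p.

Definition satisfiable (A : structure L) (V : Type) (x : V -> sort L)
    (Gamma : set (pformula (ctx_cat x (@param_ctx A)))) : Prop :=
  exists a : assignment A x,
    forall phi, Gamma phi -> sat (assign_cat a (@param_assign A)) phi.

Definition saturated (A : structure L) : Prop :=
  forall (V : Type) (x : V -> sort L)
    (Gamma : set (pformula (ctx_cat x (@param_ctx A)))),
    small K Gamma ->
    (forall Delta, Delta `<=` Gamma -> finite_set Delta -> satisfiable Delta) ->
    satisfiable Gamma.

Definition monster (T : theory L) (U : structure L) : Prop :=
  pec T U /\ homogeneous U /\ saturated U.

End Monster.

Section NIP.
Variables (L : language) (T : theory L).

Definition IP (m n : nat) (x : 'I_m -> sort L) (y : 'I_n -> sort L)
    (phi : pformula (ctx_cat x y)) : Prop :=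
  exists psi : pformula (ctx_cat x y),
    (forall A, models A T -> forall (a : assignment A x) (b : assignment A y),
       ~ (sat (assign_cat a b) phi /\ sat (assign_cat a b) psi)) /\
    exists A, models A T /\
    exists (a : nat -> assignment A x) (b : set nat -> assignment A y),
      forall (i : nat) (W : set nat),
        (W i -> sat (assign_cat (a i) (b W)) phi) /\
        (~ W i -> sat (assign_cat (a i) (b W)) psi).

Definition NIP : Prop :=
  forall m n (x : 'I_m -> sort L) (y : 'I_n -> sort L)
    (phi : pformula (ctx_cat x y)), ~ IP phi.

End NIP.

(* A set of partial types E(x, x') without parameters, as an indexed family. *)
Record ptype_family (L : language) := PtypeFamily {
  hidx : Type;
  hvar : hidx -> Type;
  htuple : forall e, hvar e -> sort L;
  hset : forall e, set (pformula (ctx_cat (@htuple e) (@htuple e)))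
}.
Arguments htuple {L p} e _.
Arguments hset {L p} e _.

Section Hyperimaginaries.
Variables (L : language) (U : structure L) (EE : ptype_family L).

Definition type_rel (e : hidx EE) (a b : assignment U (htuple e)) : Prop :=
  forall phi, hset e phi -> sat (assign_cat a b) phi.
Arguments type_rel : clear implicits.

Definition hyper_equivalences (K : Type) : Prop :=
  forall e : hidx EE,
    small K [set: hvar e] /\
    (forall a, type_rel e a a) /\
    (forall a b, type_rel e a b -> type_rel e b a) /\
    (forall a b c, type_rel e a b -> type_rel e b c -> type_rel e a c).

(* Home sorts are their own quotients by equality: an element of a home sort
   has itself as unique representative, a tuple with a single variable. *)
Definition heq_sort : Type := sort L + hidx EE.

Definition rep_var (s : heq_sort) : Type :=
  match s with inl _ => unit | inr e => hvar e end.

Definition rep_tuple (s : heq_sort) : rep_var s -> sort L :=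
  match s with inl s => fun=> s | inr e => htuple e end.
Arguments rep_tuple : clear implicits.

(* The concatenation of the tuples of variables of the sorts in t. *)
Definition rep_ctx n (t : 'I_n -> heq_sort) :
    {i : 'I_n & rep_var (t i)} -> sort L :=
  fun v => rep_tuple (t (projT1 v)) (projT2 v).
Arguments rep_ctx {n} t _.

Record heq_new_rsym := HeqNewRsym {
  nr_arity : nat;
  nr_dom : 'I_nr_arity -> heq_sort;
  nr_formula : pformula (rep_ctx nr_dom)
}.

Definition heq_language : language := {|
  sort := heq_sort;
  fsym := fsym L;
  farity := @farity L;
  fdom := fun f i => inl (fdom f i);
  fcod := fun f => inl (fcod f);
  rsym := rsym L + heq_new_rsym;
  rarity := fun r =>
    match r with inl r => rarity r | inr r => nr_arity r end;
  rdom := fun r =>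
    match r return 'I_(match r with
                       | inl r => rarity r | inr r => nr_arity r end) ->
                   heq_sort with
    | inl r => fun i => inl (rdom r i)
    | inr r => @nr_dom r
    end
|}.

(* The elements of the sort of E are the classes [a]_E = {b | E(a, b)}. *)
Definition heq_class (e : hidx EE) : Type :=
  {C : set (assignment U (htuple e)) | exists a, C = [set b | type_rel e a b]}.

Definition heq_carrier (s : heq_sort) : Type :=
  match s with inl s => U s | inr e => heq_class e end.

Definition represents (s : heq_sort) :
    heq_carrier s -> assignment U (rep_tuple s) -> Prop :=
  match s return heq_carrier s -> assignment U (rep_tuple s) -> Prop with
  | inl s => fun c a => a tt = c
  | inr e => fun c a => proj1_sig c a
  end.

Definition assign_join n (t : 'I_n -> heq_sort)
    (a : forall i, assignment U (rep_tuple (t i))) : assignment U (rep_ctx t) :=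
  fun v => a (projT1 v) (projT2 v).

Definition new_rel_int (r : heq_new_rsym)
    (c : forall i, heq_carrier (@nr_dom r i)) : Prop :=
  exists a : forall i, assignment U (rep_tuple (@nr_dom r i)),
    (forall i, represents (c i) (a i)) /\ sat (assign_join a) (nr_formula r).

Definition heq_structure : structure heq_language := {|
  carrier := heq_carrier : sort heq_language -> Type;
  fun_int := fun (f : fsym heq_language) c => fun_int U f c;
  rel_int := fun r : rsym heq_language =>
    match r return (forall i, heq_carrier (@rdom heq_language r i)) -> Prop with
    | inl r => fun c => rel_int U r c
    | inr r => fun c => @new_rel_int r c
    end
|}.

Definition heq_theory : theory heq_language := theory_of heq_structure.

End Hyperimaginaries.
Arguments heq_structure {L} U EE.
Arguments heq_theory {L} U EE.

(* Main.v *)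
From Stdlib Require List.
From mathcomp Require Import all_boot.
From mathcomp Require Import boolp classical_sets functions cardinality.
Require Import Defs.

Set Implicit Arguments.
Unset Strict Implicit.
Unset Printing Implicit Defensive.

Local Open Scope classical_set_scope.
Local Open Scope card_scope.

(** Suppose a formula [phi] on hyperimaginaries has IP, witnessed by [psi].
    Every finite part of the pattern of the points [a_i] and [b_S] is described
    by one positive formula, so it is already realised in the hyperimaginary
    extension of [U] ([finite_pattern_theory]). Choosing representatives of the
    classes brings the pattern down to [U]: in terms of representatives, a
    positive formula on hyperimaginaries amounts to a partial type over the
    empty set ([translate]). Equality of classes is the type [E] itself, while the
    new relations, and the existential quantifiers over a sort of classes,
    become existential quantifiers over small tuples of [U];
    by saturation the projection of a partial type along such a tuple is again
    a partial type ([projectionP]).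

    As [phi] and [psi] are incompatible, their types are jointly inconsistent in
    [U], and by compactness so are two formulas [phi0] and [psi0], each a finite
    conjunction taken from one of the types ([transfer_pattern]). All finite
    patterns of [(phi, psi)] are then finite patterns of [(phi0, psi0)]. Only
    finitely many variables occur in these ([finite_variables]). Saturation glues
    the finite patterns into an infinite one ([pattern_saturated]), and joint
    continuation together with the immersion property of pec models spreads
    the incompatibility from [U] to all models of [T] ([joint_sat]). This is IP
    for [T].

    Two points need care. First, saturation speaks of fewer than |K| formulas,
    whereas a partial type may contain any formula in a small tuple of
    variables; hence the cardinal arithmetic leading to [small_formulas], which
    rests on |X * X| = |X| for infinite X. It makes every set of formulas in a
    small tuple small, so that types never have to be counted again. The
    continuum, however, need not be below |K|, so the family [b_S] cannot be
    found at one stroke: the sequence [a_i], only countably many variables, is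
    chosen to satisfy the projections of all the types that the [b_S] must
    realise, and each [b_S] is then found by itself. Secondly, sorts may be
    empty, so that a formula may be satisfiable while some variable that does
    not occur in it has no value; hence the hypotheses that a tuple of
    variables has some value at all. *)

(** * Cardinal arithmetic *)

Definition embeds (X Y : Type) : Prop := exists f : X -> Y, injective f.

Lemma embeds_refl X : embeds X X.
Proof. by exists id. Qed.

Lemma embeds_trans X Y Z : embeds X Y -> embeds Y Z -> embeds X Z.
Proof. by move=> [f fI] [g gI]; exists (g \o f); exact: inj_comp. Qed.

Lemma card_le_embeds X Y : [set: X] #<= [set: Y] <-> embeds X Y.
Proof.
split=> [/card_leP[f]|[f fI]].
  exists (fun x => val (f (SigSub (mem_set (I : [set: X] x))))) => x y /val_inj.
  by move=> /(@inj _ _ _ f); rewrite !in_setT => /(_ isT isT)[].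
have fE : f @` [set: X] #= [set: X] by apply: inj_card_eq => x y _ _; exact: fI.
by rewrite -(card_le_eql fE); exact: card_leT.
Qed.

(** A maximal partial bijection between [X] and [Y] exhausts one of them. *)
Lemma embeds_total X Y : embeds X Y \/ embeds Y X.
Proof.
pose P (G : set (X * Y)) := forall p q, G p -> G q -> (p.1 = q.1 <-> p.2 = q.2).
have [|G [PG maxG]] := @Zorn_bigcup _ P.
  move=> F FP totF p q [A FA Ap] [B FB Bq].
  have [AB|BA] := totF _ _ FA FB; first by apply: (FP _ FB); [exact: AB|].
  by apply: (FP _ FA) => //; exact: BA.
have [domG|/existsNP[x0 x0P]] := pselect (forall x, exists y, G (x, y)).
  have [f fG] := choice domG; left; exists f => x y fxy.
  exact: (PG _ _ (fG x) (fG y)).2 fxy.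
right; have ranG y : exists x, G (x, y).
  apply: contrapT => yP; apply: (maxG (G `|` [set (x0, y)])).
    rewrite properEneq; split; last by move=> p; left.
    apply/eqP => GE; apply: yP; exists x0.
    by rewrite GE; right.
  move=> [a b] [a' b'] [Gp|[-> ->]] [Gq|[-> ->]] //=.
  - exact: PG Gp Gq.
  - by split=> e; [case: x0P; exists b|case: yP; exists a]; rewrite -e.
  - by split=> e; [case: x0P; exists b'|case: yP; exists a']; rewrite e.
have [f fG] := choice ranG; exists f => x y fxy.
exact: (PG _ _ (fG x) (fG y)).1 fxy.
Qed.

(** A partial witness of |X * X| <= |X|, ordered below by extension. The set is
    required to be infinite because enlarging a witness takes two distinct
    elements of it. The pairing is a total function, with irrelevant values
    outside the set. *)
Definition self_paired X (Af : set X * (X -> X -> X)) : Prop :=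
  [/\ forall x y, Af.1 x -> Af.1 y -> Af.1 (Af.2 x y),
      forall x y x' y', Af.1 x -> Af.1 y -> Af.1 x' -> Af.1 y' ->
        Af.2 x y = Af.2 x' y' -> x = x' /\ y = y' &
      exists i : nat -> X, injective i /\ forall n, Af.1 (i n)].

(** The starting point for Zorn's lemma: a countable set. *)
Lemma self_paired_range X (i : nat -> X) :
  injective i -> exists f, self_paired (range i, f).
Proof.
move=> iI; pose j x := if pselect (range i x) is left h then projT1 (cid2 h) else 0.
have jK n : j (i n) = n.
  rewrite /j; case: pselect => [h|[]]; last by exists n.
  by case: cid2 => m _ /= /iI.
exists (fun x y => i (choice.pickle (j x, j y))); split => /=.
- by move=> x y _ _; exists (choice.pickle (j x, j y)).
- move=> _ _ _ _ [a _ <-] [b _ <-] [c _ <-] [d _ <-] /iI.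
  by rewrite !jK => /(pcan_inj choice.pickleK)[-> ->].
- by exists i; split=> // n; exists n.
Qed.

Definition extends X (Af Bg : set X * (X -> X -> X)) : Prop :=
  Af.1 `<=` Bg.1 /\ forall x y, Af.1 x -> Af.1 y -> Bg.2 x y = Af.2 x y.

Lemma maximal_self_paired X : embeds nat X ->
  exists Af, @self_paired X Af /\
    forall Bg, self_paired Bg -> extends Af Bg -> Bg.1 `<=` Af.1.
Proof.
move=> [i iI]; have [f0 f0P] := self_paired_range iI.
pose T := {Af | @self_paired X Af}.
pose R (s t : T) := `[< extends (sval s) (sval t) >].
have [||C totC|[Af AfP] maxA] := @ZL_preorder T (exist _ _ f0P) R.
- by move=> t; apply/asboolP; split.
- move=> r s t /asboolP[sub1 e1] /asboolP[sub2 e2]; apply/asboolP.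
  split=> [x /sub1/sub2//|x y rx ry].
  by rewrite e2 ?e1//; exact: sub1.
- have [C0|/existsNP[t0 /contrapT Ct0]] := pselect (forall t, ~ C t).
    by exists (exist _ _ f0P) => s /C0.
  pose A x := exists2 t, C t & (sval t).1 x.
  have common x y : A x -> A y -> exists t, [/\ C t, (sval t).1 x & (sval t).1 y].
    move=> [s Cs sx] [t Ct ty].
    have [/asboolP[st _]|/asboolP[ts _]] := totC _ _ Cs Ct.
      by exists t; split=> //; exact: st.
    by exists s; split=> //; exact: ts.
  pose f x y : X := if pselect (A x /\ A y) is left h
    then (sval (projT1 (cid (common _ _ h.1 h.2)))).2 x y else x.
  have fE t x y : C t -> (sval t).1 x -> (sval t).1 y -> f x y = (sval t).2 x y.
    move=> Ct tx ty; rewrite /f; case: pselect => [h|[]]; last by split; exists t.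
    case: cid => s [Cs sx sy] /=.
    have [/asboolP[st e]|/asboolP[ts e]] := totC _ _ Cs Ct.
      by rewrite e.
    by rewrite e.
  have AfP : self_paired (A, f).
    split=> /=.
    - move=> x y Ax Ay; have [t [Ct tx ty]] := common _ _ Ax Ay.
      rewrite (fE t)//; exists t => //.
      by case: (svalP t) => h _ _; exact: h.
    - move=> x y x' y' Ax Ay Ax' Ay'.
      have [s [Cs sx sy]] := common _ _ Ax Ay.
      have [t [Ct tx ty]] := common _ _ Ax' Ay'.
      have [/asboolP[st _]|/asboolP[ts _]] := totC _ _ Cs Ct.
        have [tx' ty'] := (st _ sx, st _ sy); rewrite !(fE t)//.
        by case: (svalP t) => _ h _; exact: h.
      have [tx' ty'] := (ts _ tx, ts _ ty); rewrite !(fE s)//.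
      by case: (svalP s) => _ h _; exact: h.
    - case: (svalP t0) => _ _ [j [jI jP]]; exists j; split=> // n.
      by exists t0.
  exists (exist _ _ AfP) => s Cs; apply/asboolP; split=> /= [x sx|x y sx sy].
    by exists s.
  by rewrite (fE s).
exists Af; split=> // Bg BgP AB.
by have /asboolP[] : R (exist _ _ BgP) (exist _ _ AfP) by apply/maxA/asboolP.
Qed.

(** Comparability of [A] with its complement, where [e] takes irrelevant values
    outside the set that it is meant to embed. *)
Lemma embeds_compl X (A : set X) :
  (exists e : X -> X, (forall x, ~ A x -> A (e x)) /\
     forall x y, ~ A x -> ~ A y -> e x = e y -> x = y) \/
  (exists e : X -> X, (forall x, A x -> ~ A (e x)) /\
     forall x y, A x -> A y -> e x = e y -> x = y).
Proof.
suff ext (B C : set X) : embeds {x | B x} {x | C x} ->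
    exists e : X -> X, (forall x, B x -> C (e x)) /\
      forall x y, B x -> B y -> e x = e y -> x = y.
  by have [/ext|/ext] := embeds_total {x | ~ A x} {x | A x}; [left|right].
move=> [e eI].
exists (fun x => if pselect (B x) is left h then sval (e (exist _ _ h)) else x).
split=> [x Bx|x y Bx By]; first by case: pselect => // h; exact: svalP.
case: pselect => // h; case: pselect => // h' /= exy.
by have /eI[] : e (exist _ x h) = e (exist _ y h') by exact: eq_sig_hprop.
Qed.

(** Take a maximal [A] with a pairing [f]. Two copies of [A] embed into [A], by
    pairing with two fixed elements. If the complement of [A] embeds into [A],
    then so does all of [X], and [f] gives the claim. Otherwise the complement
    contains a copy [e @` A] of [A], and the new pairs of elements of
    [A `|` e @` A] can be sent injectively into that copy, which contradicts
    maximality. *)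
Lemma embeds_square X : embeds nat X -> embeds (X * X) X.
Proof.
move=> /maximal_self_paired[[A f] [[/= fA fI [i [iI iA]]] maxA]].
pose a0 := i 0; pose a1 := i 1.
have a01 : a0 <> a1 by move=> /iI.
have double (B : set X) (e : X -> X) : (forall x, B x -> ~ A x -> A (e x)) ->
    (forall x y, B x -> B y -> ~ A x -> ~ A y -> e x = e y -> x = y) ->
  exists j : X -> X, (forall x, B x -> A (j x)) /\
    (forall x y, B x -> B y -> j x = j y -> x = y).
  move=> eA eI.
  exists (fun x => if pselect (A x) then f a0 x else f a1 (e x)); split.
    move=> x Bx; case: pselect => Ax; apply: fA => //; try exact: iA.
    exact: eA.
  move=> x y Bx By; case: pselect => Ax; case: pselect => Ay fxy.
  - by have [] := fI _ _ _ _ (iA _) Ax (iA _) Ay fxy.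
  - by have [/a01] := fI _ _ _ _ (iA _) Ax (iA _) (eA _ By Ay) fxy.
  - by have [/esym/a01] := fI _ _ _ _ (iA _) (eA _ Bx Ax) (iA _) Ay fxy.
  - have [_ /eI] := fI _ _ _ _ (iA _) (eA _ Bx Ax) (iA _) (eA _ By Ay) fxy.
    exact.
have [[e [eA eI]]|[e [eA eI]]] := embeds_compl A.
  have [||j [jA jI]] := double setT e.
  - by move=> x _; exact: eA.
  - by move=> x y _ _; exact: eI.
  - exists (fun p => f (j p.1) (j p.2)) => -[x y] [x' y'] /=.
    move=> /fI[]; try exact: jA.
    by move=> /jI-> // /jI->.
exfalso; pose B := A `|` e @` A.
have [e' e'K] : exists e' : X -> X, forall a, A a -> e' (e a) = a.
  exists (fun x => if pselect ((e @` A) x) is left h then projT1 (cid2 h) else x).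
  move=> a Aa; case: pselect => [h|[]]; last by exists a.
  by case: cid2 => b Ab /= /eI->.
have [||j [jA jI]] := double B e'.
- by move=> x [//|[a Aa <-]] _; rewrite e'K.
- by move=> x y [//|[a Aa <-]] [//|[b Ab <-]] _ _; rewrite !e'K// => ->.
pose g x y := if pselect (A x /\ A y) then f x y else e (f (j x) (j y)).
have AB x : A x -> B x by left.
have BgP : self_paired (B, g).
  split=> /=.
  - move=> x y Bx By; rewrite /g; case: pselect => [[Ax Ay]|nA].
      by left; exact: fA.
    by right; exists (f (j x) (j y)) => //; apply: fA; exact: jA.
  - move=> x y x' y' Bx By Bx' By'; rewrite /g.
    have jfA u v : B u -> B v -> A (f (j u) (j v)) by move=> /jA ? /jA; exact: fA.
    case: pselect => [[Ax Ay]|nA]; case: pselect => [[Ax' Ay']|nA'].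
    + exact: fI.
    + by move=> /= h; case: (eA (f (j x') (j y'))); [exact: jfA|rewrite -h; exact: fA].
    + by move=> /= h; case: (eA (f (j x) (j y))); [exact: jfA|rewrite h; exact: fA].
    + move=> /eI-/(_ (jfA _ _ Bx By) (jfA _ _ Bx' By')) /fI[]; try exact: jA.
      by move=> /jI-> // /jI->.
  - by exists i; split=> // n; left; exact: iA.
have : A (e a0).
  apply: (maxA (B, g)) => //=; last by right; exists a0 => //; exact: iA.
  split=> [x /AB//|x y Ax Ay] /=; rewrite /g; case: pselect => // -[].
  by split.
by apply: eA; exact: iA.
Qed.

(** A sequence is determined by its length and its iterated pairing. *)
Lemma embeds_seq X : embeds nat X -> embeds (seq X) X.
Proof.
move=> natX; have [f fI] := embeds_square natX; have [i iI] := natX.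
pose code := foldr (fun x c => f (x, c)) (i 0).
have codeI s t : size s = size t -> code s = code t -> s = t.
  elim: s t => [|x s IH] [|y t]//= [st] /fI[-> /IH->//].
exists (fun s => f (i (size s), code s)) => s t /fI[/iI].
exact: codeI.
Qed.

Section Small.
Variable K : Type.

Lemma small_embeds X Y : embeds X Y -> small K [set: Y] -> small K [set: X].
Proof.
move=> XY [/card_le_embeds YK KY]; split.
  exact/card_le_embeds/embeds_trans/YK.
by move=> /card_le_embeds KX; apply/KY/card_le_embeds/embeds_trans/XY.
Qed.

Lemma small_set X (S : set X) : small K [set: X] -> small K S.
Proof.
move=> [XK KX]; split; first exact: card_le_trans (card_leT S) XK.
by move=> KS; apply: KX; exact: card_le_trans KS (card_leT S).
Qed.

Hypothesis natK : small K [set: nat].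

(** Sums and products of small types embed into the square of a single small
    infinite type. *)
Lemma small_max X Y : small K [set: X] -> small K [set: Y] ->
  exists M, [/\ small K [set: M], embeds nat M, embeds X M & embeds Y M].
Proof.
suff max2 Z1 Z2 : small K [set: Z1] -> small K [set: Z2] ->
    exists M, [/\ small K [set: M], embeds Z1 M & embeds Z2 M].
  move=> sX sY; have [M [sM XM YM]] := max2 _ _ sX sY.
  have [N [sN MN nN]] := max2 _ _ sM natK; exists N; split=> //.
    exact: embeds_trans XM MN.
  exact: embeds_trans YM MN.
move=> s1 s2; have [h|h] := embeds_total Z1 Z2.
  by exists Z2; split=> //; exact: embeds_refl.
by exists Z1; split=> //; exact: embeds_refl.
Qed.

Lemma small_sum X Y : small K [set: X] -> small K [set: Y] -> small K [set: X + Y].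
Proof.
move=> sX sY; have [M [sM nM [f fI] [g gI]]] := small_max sX sY.
have [i iI] := nM.
apply: small_embeds sM; apply: embeds_trans (embeds_square nM).
exists (fun s => match s with inl x => (i 0, f x) | inr y => (i 1, g y) end).
by move=> [x|y] [x'|y'] [] => [/fI->|/iI|/iI|/gI->].
Qed.

Lemma small_prod X Y : small K [set: X] -> small K [set: Y] -> small K [set: X * Y].
Proof.
move=> sX sY; have [M [sM nM [f fI] [g gI]]] := small_max sX sY.
apply: small_embeds sM; apply: embeds_trans (embeds_square nM).
by exists (fun p => (f p.1, g p.2)) => -[x y] [x' y'] /= [/fI-> /gI->].
Qed.

Lemma small_seq X : small K [set: X] -> small K [set: seq X].
Proof.
move=> sX; have [M [sM nM [f fI] _]] := small_max sX sX.
apply: small_embeds sM; apply: embeds_trans (embeds_seq nM).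
by exists (map f); exact: inj_map.
Qed.

Lemma small_countable (X : countType) : small K [set: X].
Proof. by apply: small_embeds natK; exists choice.pickle; exact: pcan_inj choice.pickleK. Qed.

Lemma small_sigma_ord n (F : 'I_n -> Type) :
  (forall i, small K [set: F i]) -> small K [set: {i & F i}].
Proof.
elim: n F => [|n IH] F sF.
  by apply: small_embeds natK; exists (fun=> 0) => -[[]].
have := small_sum (sF ord0) (IH (fun j => F (lift ord0 j)) (fun j => sF _)).
apply: small_embeds.
have inv (p : {i & F i}) : exists q : F ord0 + {j & F (lift ord0 j)},
    p = match q with inl c => existT _ ord0 c
                   | inr q => existT _ (lift ord0 (projT1 q)) (projT2 q) end.
  case: p => i c; case: (unliftP ord0 i) c => [j ->|->] c.
    by exists (inr (existT _ j c)).
  by exists (inl c).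
have [f fP] := choice inv.
by exists f => p q fpq; rewrite (fP p) (fP q) fpq.
Qed.

End Small.

(** * Counting formulas *)

Lemma projT2_inj (X : Type) (P : X -> Type) x (p q : P x) :
  existT P x p = existT P x q -> p = q.
Proof.
move=> e; have := projT2_eq e => /=.
by rewrite (Prop_irrelevance (projT1_eq e) erefl).
Qed.

(** Formulas are encoded as words in Polish notation. No sort is recorded for the
    terms, since a term determines its sort; hence injectivity is stated for
    dependent pairs. It is proved for words followed by arbitrary ones, as in
    [enc_term_inj], because a code contains several codes in a row. *)
Section Encoding.
Variables (L : language) (V0 : Type).

Definition symbol : Type := nat + sort L + fsym L + rsym L + V0.

Notation sym_nat k := (inl (inl (inl (inl k))) : symbol).
Notation sym_sort s := (inl (inl (inl (inr s))) : symbol).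
Notation sym_fun f := (inl (inl (inr f)) : symbol).
Notation sym_rel r := (inl (inr r) : symbol).

Definition sym_var (v : V0 + nat) : symbol :=
  match v with inl v => inr v | inr k => sym_nat k end.

Lemma sym_var_inj : injective sym_var.
Proof. by move=> [v|k] [v'|k'] //= [->]. Qed.

Fixpoint enc_term V (x : V -> sort L) (rho : V -> V0 + nat) s (t : term x s) :
    seq symbol :=
  match t with
  | Var v => [:: sym_var (rho v)]
  | App f t => sym_fun f ::
      flatten [seq enc_term rho (t i) | i <- enum 'I_(farity f)]
  end.

(** The right summand holds the de Bruijn indices of the quantified variables, so
    that one alphabet serves for formulas in all contexts. *)
Definition shift V (rho : V -> V0 + nat) (v : option V) : V0 + nat :=
  match v with
  | Some v => match rho v with inl v => inl v | inr k => inr k.+1 end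
  | None => inr 0
  end.

Lemma shift_inj V (rho : V -> V0 + nat) : injective rho -> injective (shift rho).
Proof.
move=> rhoI [v|] [v'|] //=.
- case e: (rho v) => [w|k]; case e': (rho v') => [w'|k'] // [h];
  by congr Some; apply: rhoI; rewrite e e' h.
- by case: (rho v).
- by case: (rho v').
Qed.

Fixpoint enc V (x : V -> sort L) (rho : V -> V0 + nat) (phi : pformula x) :
    seq symbol :=
  match phi with
  | PTop => [:: sym_nat 0]
  | PBot => [:: sym_nat 1]
  | PEq s t u => sym_nat 2 :: enc_term rho t ++ enc_term rho u
  | PRel r t => sym_rel r ::
      flatten [seq enc_term rho (t i) | i <- enum 'I_(rarity r)]
  | PAnd phi psi => sym_nat 3 :: enc rho phi ++ enc rho psi
  | POr phi psi => sym_nat 4 :: enc rho phi ++ enc rho psi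
  | PEx s phi => [:: sym_nat 5, sym_sort s & enc (shift rho) phi]
  end.

Lemma flatten_prefix_inj (I : eqType) (F G : I -> seq symbol) (Q : I -> Prop)
    (r : seq I) l l' :
  (forall i m m', F i ++ m = G i ++ m' -> Q i /\ m = m') ->
  flatten (map F r) ++ l = flatten (map G r) ++ l' ->
  (forall i, i \in r -> Q i) /\ l = l'.
Proof.
move=> FG; elim: r => [|i r IH] /=; first by [].
rewrite -!catA => /FG[Qi /IH[Qr ->]]; split=> // j.
by rewrite inE => /predU1P[->|/Qr].
Qed.

Lemma enc_term_inj V (x : V -> sort L) (rho : V -> V0 + nat) s (t : term x s) :
  injective rho -> forall s' (t' : term x s') l l',
  enc_term rho t ++ l = enc_term rho t' ++ l' ->
  existT (term x) s t = existT (term x) s' t' /\ l = l'.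
Proof.
move=> rhoI; elim: t => [v|f t IH] s' [v'|f' t'] l l' //=.
- by move=> [/sym_var_inj/rhoI-> ->].
- by case: (rho v).
- by case: (rho v').
- move=> [ff']; case: _ / ff' t' => t' /(flatten_prefix_inj
    (Q := fun i => existT (term x) _ (t i) = existT (term x) _ (t' i)))[].
    by move=> i m m'; exact: IH.
  move=> tt' ->; split=> //; congr existT; congr App.
  by apply: functional_extensionality_dep => i; apply/projT2_inj/tt'; rewrite mem_enum.
Qed.

Lemma enc_inj V (x : V -> sort L) (rho : V -> V0 + nat) (phi : pformula x) :
  injective rho -> forall (psi : pformula x) l l',
  enc rho phi ++ l = enc rho psi ++ l' -> phi = psi /\ l = l'.
Proof.
elim: phi rho => {V x} [V x|V x|V x s t u|V x r t|V x p1 IH1 p2 IH2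
  |V x p1 IH1 p2 IH2|V x s p IH] rho rhoI [||s' t' u'|r' t'|q1 q2|q1 q2|s' q] l l' //=.
- by move=> [->].
- by move=> [->].
- rewrite -!catA => -[] /(enc_term_inj rhoI)[tt'].
  have ss' : s = s' := projT1_eq tt'.
  subst s'; rewrite -(projT2_inj tt').
  by move=> /(enc_term_inj rhoI)[uu' ->]; rewrite -(projT2_inj uu').
- move=> [rr']; case: _ / rr' t' => t' /(flatten_prefix_inj
    (Q := fun i => existT (term x) _ (t i) = existT (term x) _ (t' i)))[].
    by move=> i m m'; exact: enc_term_inj.
  move=> tt' ->; split=> //; congr PRel.
  by apply: functional_extensionality_dep => i; apply/projT2_inj/tt'; rewrite mem_enum.
- by rewrite -!catA => -[] /(IH1 _ rhoI)[-> /(IH2 _ rhoI)[-> ->]].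
- by rewrite -!catA => -[] /(IH1 _ rhoI)[-> /(IH2 _ rhoI)[-> ->]].
- move=> [ss']; case: _ / ss' q => q.
  by move=> /(IH _ (shift_inj rhoI))[-> ->].
Qed.

End Encoding.

Lemma small_nat (L : language) (K : Type) :
  sufficiently_large L K -> small K [set: nat].
Proof.
by apply: small_embeds; exists (fun k => inl (inl (inl k))) => k l [].
Qed.

(** The codes are words over the sum of the symbols of [L] and of the variables,
    which is small as a sum of two small types. *)
Lemma small_formulas (L : language) (K V : Type) (x : V -> sort L) :
  sufficiently_large L K -> small K [set: V] -> small K [set: pformula x].
Proof.
move=> sL sV.
have natK := small_nat sL.
apply: small_embeds (small_seq natK (small_sum natK sL sV)).
exists (@enc L V V x inl) => phi psi e.
have : injective (@inl V nat) by move=> ? ? [].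
by move=> /(@enc_inj _ _ _ _ _ phi) /(_ psi [::] [::])[]; rewrite ?cats0.
Qed.

(** * Substitution, and the variables that occur *)

Section Substitution.
Variable L : language.

Fixpoint subst_term V W (x : V -> sort L) (y : W -> sort L)
    (sigma : forall v, term y (x v)) s (t : term x s) : term y s :=
  match t with
  | Var v => sigma v
  | App f t => App (fun i => subst_term sigma (t i))
  end.

Definition weaken W (y : W -> sort L) s s' (t : term y s') : term (ctx_ext y s) s' :=
  subst_term (fun w => Var (ctx_ext y s) (Some w)) t.

Definition subst_under V W (x : V -> sort L) (y : W -> sort L) s
    (sigma : forall v, term y (x v)) (v : option V) :
    term (ctx_ext y s) (ctx_ext x s v) :=
  match v with
  | Some v => weaken s (sigma v)
  | None => Var (ctx_ext y s) None
  end.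

Fixpoint subst V W (x : V -> sort L) (y : W -> sort L)
    (sigma : forall v, term y (x v)) (phi : pformula x) : pformula y :=
  match phi with
  | PTop => PTop y
  | PBot => PBot y
  | PEq _ t u => PEq (subst_term sigma t) (subst_term sigma u)
  | PRel r t => PRel (fun i => subst_term sigma (t i))
  | PAnd phi psi => PAnd (subst sigma phi) (subst sigma psi)
  | POr phi psi => POr (subst sigma phi) (subst sigma psi)
  | PEx s phi => PEx (subst (@subst_under _ _ _ _ s sigma) phi)
  end.

Lemma eval_subst (A : structure L) V W (x : V -> sort L) (y : W -> sort L)
    (sigma : forall v, term y (x v)) (a : assignment A y) s (t : term x s) :
  eval a (subst_term sigma t) = eval (fun v => eval a (sigma v)) t.
Proof.
elim: t => //= f t IH; congr fun_int.
by apply: functional_extensionality_dep => i; exact: IH.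
Qed.

Lemma eval_weaken (A : structure L) W (y : W -> sort L) s s' (t : term y s')
    (a : assignment A y) (c : A s) :
  eval (assign_ext a c) (weaken s t) = eval a t.
Proof. by rewrite eval_subst. Qed.

Lemma sat_subst (A : structure L) V W (x : V -> sort L) (y : W -> sort L)
    (sigma : forall v, term y (x v)) (phi : pformula x) (a : assignment A y) :
  sat a (subst sigma phi) = sat (fun v => eval a (sigma v)) phi.
Proof.
elim: phi W y sigma a => {V x} [V x|V x|V x s t u|V x r t|V x p IHp q IHq
  |V x p IHp q IHq|V x s p IH] W y sigma a //=.
- by rewrite !eval_subst.
- congr rel_int; apply: functional_extensionality_dep => i.
  exact: eval_subst.
- by rewrite IHp IHq.
- by rewrite IHp IHq.
- congr ex; apply: funext => c; rewrite IH; congr sat.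
  by apply: functional_extensionality_dep => -[v|] //=; rewrite eval_weaken.
Qed.

(** [phi] mentions only variables listed in [s], in a form that avoids renaming
    bound variables and casting sorts: to move [phi] to another context it is
    enough to have terms for the variables in [s]. The relation [R] says which
    assignments correspond; it ranges over all structures at once, so that the
    formula obtained does not depend on the structure. *)
Definition supported V (z : V -> sort L) (phi : pformula z) (s : list V) : Prop :=
  forall V' (z' : V' -> sort L)
    (R : forall A : structure L, assignment A z -> assignment A z' -> Prop),
  (forall v, List.In v s -> exists t : term z' (z v),
     forall A a a', R A a a' -> eval a' t = a v) ->
  exists phi' : pformula z', forall A a a', R A a a' -> (sat a phi <-> sat a' phi').

Lemma supportedS V (z : V -> sort L) (phi : pformula z) (s s' : list V) :
  (forall v, List.In v s -> List.In v s') -> supported phi s -> supported phi s'.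
Proof. by move=> ss' sup V' z' R Rs; apply: sup => v /ss'/Rs. Qed.

Lemma In_pmap V W (f : V -> option W) (l : list V) v w :
  List.In v l -> f v = Some w -> List.In w (pmap f l).
Proof.
move=> + fv; elim: l => //= u l IH [->|/IH wl]; first by rewrite fv; left.
by case: (f u) => [w'|] //=; right.
Qed.

Lemma finite_union (I : Type) V (F : I -> list V) (r : list I) :
  exists s, forall i, List.In i r -> forall v, List.In v (F i) -> List.In v s.
Proof.
elim: r => [|i r [s sP]]; first by exists [::].
exists (F i ++ s) => j [<-|jr] v vF; apply/List.in_app_iff; [by left|right].
exact: sP vF.
Qed.

Lemma ord_union n V (F : 'I_n -> list V) :
  exists s, forall i v, List.In v (F i) -> List.In v s.
Proof.
have inE (r : seq 'I_n) i : i \in r -> List.In i r.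
  by elim: r => //= j r IH; rewrite inE => /predU1P[->|/IH]; [left|right].
have [s sP] := finite_union F (enum 'I_n).
by exists s => i v; apply/sP/inE; rewrite mem_enum.
Qed.

Lemma term_supported V (z : V -> sort L) s (t : term z s) : exists l : list V,
  forall V' (z' : V' -> sort L)
    (R : forall A : structure L, assignment A z -> assignment A z' -> Prop),
  (forall v, List.In v l -> exists t : term z' (z v),
     forall A a a', R A a a' -> eval a' t = a v) ->
  exists t' : term z' s, forall A a a', R A a a' -> eval a' t' = eval a t.
Proof.
elim: t => [v|f t IH].
  by exists [:: v] => V' z' R /(_ v); apply; left.
pose F i := projT1 (cid (IH i)); have [l lP] := ord_union F.
exists l => V' z' R Rl.
have tr i : exists t' : term z' (fdom f i), forall A a a', R A a a' ->
    eval a' t' = eval a (t i).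
  by apply: (projT2 (cid (IH i))) => v /lP; exact: Rl.
exists (App (fun i => projT1 (cid (tr i)))) => A a a' Raa' /=; congr fun_int.
by apply: functional_extensionality_dep => i; exact: (projT2 (cid (tr i))).
Qed.

Lemma formula_supported V (z : V -> sort L) (phi : pformula z) :
  exists s, supported phi s.
Proof.
elim: phi => {V z} [V z|V z|V z s t u|V z r t|V z p [l lP] q [m mP]
  |V z p [l lP] q [m mP]|V z s p [l lP]].
- by exists [::] => V' z' R _; exists (PTop z').
- by exists [::] => V' z' R _; exists (PBot z').
- have [l lP] := term_supported t; have [m mP] := term_supported u.
  exists (l ++ m) => V' z' R Rlm.
  have [v vl|t' t'P] := lP V' z' R; first by apply: Rlm; apply/List.in_app_iff; left.
  have [v vm|u' u'P] := mP V' z' R; first by apply: Rlm; apply/List.in_app_iff; right.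
  by exists (PEq t' u') => A a a' Raa' /=; rewrite (t'P _ _ _ Raa') (u'P _ _ _ Raa').
- pose F i := projT1 (cid (term_supported (t i))); have [l lP] := ord_union F.
  exists l => V' z' R Rl.
  have tr i : exists t' : term z' (rdom r i), forall A a a', R A a a' ->
      eval a' t' = eval a (t i).
    by apply: (projT2 (cid (term_supported (t i)))) => v /lP; exact: Rl.
  exists (PRel (fun i => projT1 (cid (tr i)))) => A a a' Raa' /=.
  suff -> : (fun i => eval a' (projT1 (cid (tr i)))) = fun i => eval a (t i) by [].
  by apply: functional_extensionality_dep => i; exact: (projT2 (cid (tr i))).
- exists (l ++ m) => V' z' R Rlm.
  have [v vl|p' p'P] := lP V' z' R; first by apply: Rlm; apply/List.in_app_iff; left.
  have [v vm|q' q'P] := mP V' z' R; first by apply: Rlm; apply/List.in_app_iff; right.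
  by exists (PAnd p' q') => A a a' Raa' /=; rewrite (p'P _ _ _ Raa') (q'P _ _ _ Raa').
- exists (l ++ m) => V' z' R Rlm.
  have [v vl|p' p'P] := lP V' z' R; first by apply: Rlm; apply/List.in_app_iff; left.
  have [v vm|q' q'P] := mP V' z' R; first by apply: Rlm; apply/List.in_app_iff; right.
  by exists (POr p' q') => A a a' Raa' /=; rewrite (p'P _ _ _ Raa') (q'P _ _ _ Raa').
- exists (pmap id l) => V' z' R Rl.
  have lin v : List.In (Some v) l -> List.In v (pmap id l).
    by move=> vl; exact: In_pmap vl _.
  have [[v /lin/Rl[t tP]|_]|p' p'P] := lP (option V') (ctx_ext z' s)
      (fun A a a' => R A (fun v => a (Some v)) (fun v => a' (Some v)) /\ a None = a' None).
  + exists (weaken s t) => A a a' [/tP <- _].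
    by rewrite eval_subst.
  + by exists (Var (ctx_ext z' s) None) => A a a' [].
  + exists (PEx p') => A a a' Raa' /=.
    have pE c := p'P A (assign_ext a c) (assign_ext a' c) (conj Raa' erefl).
    by split=> -[c /pE pc]; exists c.
Qed.

(** Existential quantification over a possibly infinite tuple [y] only concerns
    the variables of [y] that occur. *)
Section Elimination.
Variables (V W : Type) (x : V -> sort L) (y : W -> sort L).

(** The context [z'] adds to [x] one bound variable for each entry of [l]. Entries
    of [l] may be repeated: [slot] then refers to one of the copies, and the others
    are harmless. *)
Lemma quantify_list (l : list W) :
  exists V' (z' : V' -> sort L) (up : forall v, term z' (x v))
      (slot : forall w, List.In w l -> term z' (y w)),
    (forall A (a : assignment A x) (b : assignment A y), exists a' : assignment A z',
       (forall v, eval a' (up v) = a v) /\ (forall w h, eval a' (slot w h) = b w)) /\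
    (forall phi : pformula z', exists chi : pformula x,
       forall A (a : assignment A x), sat a chi <-> exists a' : assignment A z',
         (forall v, eval a' (up v) = a v) /\ sat a' phi).
Proof.
elim: l => [|w0 l [V' [z' [up [slot [fill quant]]]]]].
  exists V, x, (Var x), (fun w h => False_rect _ h); split=> [A a b|phi].
    by exists a.
  exists phi => A a; split=> [sa|[a' [a'a sa']]]; first by exists a.
  by have -> : a = a' by apply: functional_extensionality_dep => v; rewrite -a'a.
have slotP w (h : List.In w (w0 :: l)) :
    exists t : term (ctx_ext z' (y w0)) (y w), forall A a' (b : assignment A y),
      (forall w h, eval a' (slot w h) = b w) -> eval (assign_ext a' (b w0)) t = b w.
  case: h => [<-|h]; first by exists (Var (ctx_ext z' (y w0)) None).
  by exists (weaken _ (slot w h)) => A a' b slotb; rewrite eval_weaken.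
exists (option V'), (ctx_ext z' (y w0)), (fun v => weaken _ (up v)),
  (fun w h => projT1 (cid (slotP w h))); split=> [A a b|phi].
  have [a' [a'a a'b]] := fill A a b; exists (assign_ext a' (b w0)).
  split=> [v|w h]; first by rewrite eval_weaken.
  exact: (projT2 (cid (slotP w h))).
have [chi chiP] := quant (PEx phi); exists chi => A a.
rewrite chiP; split=> [[a' [a'a [c sc]]]|[a' [a'a sa']]].
  by exists (assign_ext a' c); split=> // v; rewrite eval_weaken.
exists (fun v => a' (Some v)); split=> [v|]; first by rewrite -a'a eval_subst.
exists (a' None); congr sat: sa'.
by apply: functional_extensionality_dep => -[].
Qed.

(** The formula [chi] only asks for values of the variables of [y] that occur in
    [phi]. To get back an assignment of all of [y] one needs some assignment to
    complete these values with. *)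
Lemma eliminate (phi : pformula (ctx_cat x y)) : exists chi : pformula x,
  forall A (a : assignment A x),
    ((exists b, sat (assign_cat a b) phi) -> sat a chi) /\
    (inhabited (assignment A y) -> sat a chi -> exists b, sat (assign_cat a b) phi).
Proof.
have [s sP] := formula_supported phi.
pose l := pmap (fun v : V + W => if v is inr w then Some w else None) s.
have ls w : List.In (inr w) s -> List.In w l.
  by move=> ws; exact: In_pmap ws _.
have [V' [z' [up [slot [fill quant]]]]] := quantify_list l.
have [|phi' phiP] := sP V' z' (fun A ab a' => (forall v, eval a' (up v) = ab (inl v)) /\
    (forall w h, eval a' (slot w h) = ab (inr w))).
  move=> [v _|w /ls h]; first by exists (up v) => A a a' [-> _].
  by exists (slot w h) => A a a' [_ ->].
have [chi chiP] := quant phi'; exists chi => A a; rewrite chiP; split.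
  move=> [b sb]; have [a' [a'a a'b]] := fill A a b.
  by exists a'; split=> //; apply/(phiP A (assign_cat a b) a').
move=> [b0] [a' [a'a sa']].
exists (fun w => if pselect (List.In w l) is left h then eval a' (slot w h) else b0 w).
apply/(phiP A _ a') => //; split=> // w h /=; case: pselect => // h'.
by rewrite (Prop_irrelevance h h').
Qed.

End Elimination.

End Substitution.

(** * Finite tuples of variables, and sentences *)

Section Sentences.
Variable L : language.

Lemma list_ord V (l : list V) :
  exists n (f : 'I_n -> V), forall v, List.In v l -> exists i, f i = v.
Proof.
elim: l => [|v l [n [f fP]]].
  by exists 0, (fun i : 'I_0 => False_rect _ (notF (ltn_ord i))).
exists n.+1, (fun i => if unlift ord0 i is Some j then f j else v) => w [<-|/fP[i <-]].
  by exists ord0; rewrite unlift_none.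
by exists (lift ord0 i); rewrite liftK.
Qed.

(** Two formulas are treated together because IP asks for them in the same pair of
    finite tuples. The last clause carries incompatibility of [phi] and [psi] over
    to [phi'] and [psi']. *)
Lemma finite_variables V W (x : V -> sort L) (y : W -> sort L)
    (phi psi : pformula (ctx_cat x y)) :
  exists m (f : 'I_m -> V) n (g : 'I_n -> W)
      (phi' psi' : pformula (ctx_cat (x \o f) (y \o g))),
    (forall A (a : assignment A x) (b : assignment A y),
      let ab' := @assign_cat _ A _ _ (x \o f) (y \o g) (fun i => a (f i)) (fun j => b (g j)) in
      (sat (assign_cat a b) phi -> sat ab' phi') /\
      (sat (assign_cat a b) psi -> sat ab' psi')) /\
    (forall A (a' : assignment A (x \o f)) (b' : assignment A (y \o g)),
      inhabited (assignment A x) -> inhabited (assignment A y) ->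
      @sat _ A _ _ (assign_cat a' b') phi' -> @sat _ A _ _ (assign_cat a' b') psi' ->
      exists (a : assignment A x) (b : assignment A y),
        sat (assign_cat a b) phi /\ sat (assign_cat a b) psi).
Proof.
have [l1 l1P] := formula_supported phi; have [l2 l2P] := formula_supported psi.
pose l := l1 ++ l2.
have {l1P}supp := supportedS (fun v vl => (List.in_app_iff l1 l2 v).2 (or_introl vl)) l1P.
have {l2P}supq := supportedS (fun v vl => (List.in_app_iff l1 l2 v).2 (or_intror vl)) l2P.
have [m [f fP]] := list_ord (pmap (fun v : V + W => if v is inl v then Some v else None) l).
have [n [g gP]] := list_ord (pmap (fun v : V + W => if v is inr v then Some v else None) l).
have {}fP v : List.In (inl v) l -> exists i, f i = v by move=> vl; apply/fP/(In_pmap vl).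
have {}gP v : List.In (inr v) l -> exists i, g i = v by move=> vl; apply/gP/(In_pmap vl).
have slotP v : List.In v l -> exists t : term (ctx_cat (x \o f) (y \o g)) (ctx_cat x y v),
    forall A (a : assignment A x) (b : assignment A y),
    eval (@assign_cat _ A _ _ (x \o f) (y \o g) (fun i => a (f i)) (fun j => b (g j))) t
      = assign_cat a b v.
  case: v => v => [/fP|/gP] [i <-].
    by exists (Var (ctx_cat (x \o f) (y \o g)) (inl i)).
  by exists (Var (ctx_cat (x \o f) (y \o g)) (inr i)).
pose slot v h := projT1 (cid (slotP v h)).
pose R A (ab : assignment A (ctx_cat x y)) (ab' : assignment A (ctx_cat (x \o f) (y \o g))) :=
  forall v h, eval ab' (slot v h) = ab v.
have slotR v (h : List.In v l) : exists t : term (ctx_cat (x \o f) (y \o g)) (ctx_cat x y v),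
    forall A (a : assignment A (ctx_cat x y)) a', R A a a' -> eval a' t = a v.
  by exists (slot v h) => A a a'; exact.
have [phi' phiP] := supp _ _ R slotR; have [psi' psiP] := supq _ _ R slotR.
exists m, f, n, g, phi', psi'; split=> [A a b ab'|A a' b' [a0] [b0] sphi spsi].
  have Rab : R A (assign_cat a b) ab' by move=> v h; exact: (projT2 (cid (slotP v h))).
  by split=> [/(phiP _ _ _ Rab)|/(psiP _ _ _ Rab)].
pose ab v : A (ctx_cat x y v) :=
  if pselect (List.In v l) is left h then eval (assign_cat a' b') (slot v h)
  else assign_cat a0 b0 v.
exists (fun v => ab (inl v)), (fun w => ab (inr w)).
have Rab : R A (assign_cat (fun v => ab (inl v)) (fun w => ab (inr w))) (assign_cat a' b').
  move=> v h; have -> : assign_cat (fun v => ab (inl v)) (fun w => ab (inr w)) v = ab v.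
    by case: (v).
  by rewrite /ab; case: pselect => // h'; rewrite (Prop_irrelevance h h').
by split; [apply/(phiP _ _ _ Rab)|apply/(psiP _ _ _ Rab)].
Qed.

Definition no_vars (i : 'I_0) : sort L := False_rect _ (notF (ltn_ord i)).

Lemma existential_closure V (z : V -> sort L) (phi : pformula z) :
  exists chi : pformula no_vars, forall A (e : assignment A no_vars),
    ((exists a : assignment A z, sat a phi) -> sat e chi) /\
    (inhabited (assignment A z) -> sat e chi -> exists a : assignment A z, sat a phi).
Proof.
have [chi chiP] := eliminate
  (subst (y := ctx_cat no_vars z) (fun v => Var (ctx_cat no_vars z) (inr v)) phi).
exists chi => A e; have [ex1 ex2] := chiP A e; split=> [[a sa]|inh /(ex2 inh)[a]].
  by apply: ex1; exists a; rewrite sat_subst.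
by rewrite sat_subst; exists a.
Qed.

Lemma no_assignment (A : structure L) : assignment A no_vars.
Proof. by move=> i; exact: (False_rect _ (notF (ltn_ord i))). Qed.

(** If [B] had no solution, the h-inductive sentence that denies the existential
    closure of [phi] would hold in [B], hence in [A]. The same argument with
    the sentence that a sort has an element shows that all the sorts
    involved are inhabited in [B]. *)
Lemma theory_of_sat (A B : structure L) V (z : V -> sort L) (phi : pformula z)
    (a : assignment A z) :
  models A (theory_of B) -> sat a phi -> exists b : assignment B z, sat b phi.
Proof.
move=> AB sa.
have transfer (chi : pformula no_vars) e e' : @sat _ A _ _ e chi -> @sat _ B _ _ e' chi.
  move=> se; apply: contrapT => ne'.
  apply: (AB (HInductive chi (PBot _)) _ e se) => e'' /= se''.
  have e''E : e'' = e' by apply: functional_extensionality_dep => -[].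
  by apply: ne'; rewrite -e''E.
have pts v : inhabited (B (z v)).
  have [//|c _] := transfer (PEx (s := z v) (PTop _))
    (no_assignment A) (no_assignment B).
    by exists (a v).
  by [].
have inh : inhabited (assignment B z).
  by constructor=> v; case: (cid (let: inhabits c := pts v in ex_intro xpredT c isT)).
have [chi chiP] := existential_closure phi.
apply: (chiP B (no_assignment B)).2 => //.
by apply: transfer (no_assignment A) _ _; apply: (chiP A _).1; exists a.
Qed.

(** The existential closure of [phi] goes from [A] up to a common continuation [C]
    of [A] and [U], and from [C] down to [U], which is immersed in [C]. *)
Lemma joint_sat (T : theory L) (A U : structure L) V (z : V -> sort L)
    (phi : pformula z) (a : assignment A z) :
  joint_continuation T -> pec T U -> models A T ->
  inhabited (assignment U z) -> sat a phi -> exists u : assignment U z, sat u phi.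
Proof.
move=> jcp [UT Upec] AT inh sa.
have [C [CT [[f fhom] [g ghom]]]] := jcp A U AT UT.
have [chi chiP] := existential_closure phi.
have : sat (map_assign f (no_assignment A)) chi.
  by apply: fhom; apply: (chiP A _).1; exists a.
have -> : map_assign f (no_assignment A) = map_assign g (no_assignment U).
  by apply: functional_extensionality_dep => -[].
by move=> /(Upec _ _ CT ghom); exact: (chiP U _).2.
Qed.

End Sentences.

(** * Compactness and projections of types *)

Section Compactness.
Variables (L : language) (K : Type) (U : structure L).
Hypotheses (sL : sufficiently_large L K) (Usat : saturated K U).

Inductive conj_of V (z : V -> sort L) (Gamma : set (pformula z)) : pformula z -> Prop :=
| conj_nil : conj_of Gamma (PTop z)
| conj_cons phi delta : Gamma phi -> conj_of Gamma delta -> conj_of Gamma (PAnd phi delta).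

Lemma small_image X Y (f : X -> Y) (S : set X) : small K S -> small K (f @` S).
Proof.
move=> [SK KS]; split; first exact: card_le_trans (card_image_le f S) SK.
by move=> h; apply/KS/(card_le_trans h)/card_image_le.
Qed.

(** Saturation for formulas over [U] that arise from the formulas in [Gamma] by
    replacing some variables by parameters; smallness is then a matter of the
    variables of [Gamma] alone. *)
Lemma compactness_param V W (z : V -> sort L) (y : W -> sort L)
    (sigma : forall v, term (ctx_cat y (@param_ctx L U)) (z v))
    (Gamma : set (pformula z)) :
  small K [set: V] ->
  (forall delta, conj_of Gamma delta ->
    satisfiable [set subst sigma delta]) ->
  satisfiable (subst sigma @` Gamma).
Proof.
move=> sV fin; apply: Usat.
  exact/small_image/small_set/(small_formulas _ sL sV).
move=> Delta DG /(@finite_seqP {classic (pformula (ctx_cat y (@param_ctx L U)))})[s sE].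
have [delta [dG dP]] : exists delta, conj_of Gamma delta /\
    forall b : assignment U y, sat (assign_cat b (@param_assign L U)) (subst sigma delta) ->
      forall phi, phi \in s -> sat (assign_cat b (@param_assign L U)) phi.
  have : forall phi, phi \in s -> (subst sigma @` Gamma) phi.
    by move=> phi phis; apply: DG; rewrite sE.
  elim: s {sE} => [|phi s IH] sG; first by exists (PTop z); split=> //; exact: conj_nil.
  have [|delta [dG dP]] := IH; first by move=> psi psis; apply: sG; rewrite inE psis orbT.
  have [|gamma gG gE] := sG phi; first by rewrite inE eqxx.
  exists (PAnd gamma delta); split; first exact: conj_cons.
  by move=> b /= [sg /dP sd] psi; rewrite inE => /predU1P[->|/sd//]; rewrite -gE.
have [b sb] := fin _ dG; exists b => phi; rewrite sE /= => phis.
exact: dP (sb _ erefl) _ phis.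
Qed.

Lemma compactness V (z : V -> sort L) (Gamma : set (pformula z)) :
  small K [set: V] ->
  (forall delta, conj_of Gamma delta -> exists a : assignment U z, sat a delta) ->
  exists a : assignment U z, forall phi, Gamma phi -> sat a phi.
Proof.
move=> sV fin.
have [|a aP] := compactness_param
  (sigma := fun v => Var (ctx_cat z (@param_ctx L U)) (inl v)) (Gamma := Gamma) sV.
  by move=> delta /fin[a sa]; exists a => _ ->; rewrite sat_subst.
exists a => phi phiG; have := aP (subst _ phi) (imageP _ phiG).
by rewrite sat_subst.
Qed.

Section Projection.
Variables (V W : Type) (x : V -> sort L) (y : W -> sort L).
Hypothesis sVW : small K [set: V + W].

(** The variables [x] are replaced by the elements [a] as parameters. *)
Lemma relative_compactness (Gamma : set (pformula (ctx_cat x y))) (a : assignment U x) :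
  (forall delta, conj_of Gamma delta -> exists b, sat (assign_cat a b) delta) ->
  exists b : assignment U y, forall phi, Gamma phi -> sat (assign_cat a b) phi.
Proof.
move=> fin; pose yU := ctx_cat y (@param_ctx L U).
pose sigma (v : V + W) : term yU (ctx_cat x y v) :=
  match v with inl v => Var yU (inr (existT _ (x v) (a v))) | inr w => Var yU (inl w) end.
have sigmaE b : (fun v => eval (assign_cat b (@param_assign L U)) (sigma v))
    = assign_cat a b.
  by apply: functional_extensionality_dep => -[].
have [|b bP] := compactness_param (sigma := sigma) (Gamma := Gamma) sVW.
  by move=> delta /fin[b sb]; exists b => _ ->; rewrite sat_subst sigmaE.
exists b => phi phiG; have := bP _ (imageP _ phiG).
by rewrite sat_subst sigmaE.
Qed.

(** The consequences, in the variables [x] alone, of finite parts of [Gamma].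
    Keeping track of the finite part is what makes finite satisfiability of a
    union of projections follow from that of the types projected. *)
Definition projection (Gamma : set (pformula (ctx_cat x y))) : set (pformula x) :=
  [set chi | exists2 delta, conj_of Gamma delta &
    forall (a : assignment U x) b, sat (assign_cat a b) delta -> sat a chi].

Lemma conj_of_sat (Z : Type) (z : Z -> sort L) (Gamma : set (pformula z))
    (a : assignment U z) delta :
  (forall phi, Gamma phi -> sat a phi) -> conj_of Gamma delta -> sat a delta.
Proof. by move=> aG; elim=> // phi d /aG sphi _ sd. Qed.

(** The existential quantifier over a small tuple commutes with the infinite
    conjunction [Gamma]. If the tuple [y] has no value at all in [U], then the
    projection contains falsity, as a consequence of the empty part of [Gamma]. *)
Lemma projectionP (Gamma : set (pformula (ctx_cat x y))) (a : assignment U x) :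
  (exists b : assignment U y, forall phi, Gamma phi -> sat (assign_cat a b) phi) <->
  (forall chi, projection Gamma chi -> sat a chi).
Proof.
split=> [[b bG] chi [delta dG dchi]|aP].
  by apply: (dchi a b); exact: conj_of_sat bG dG.
have [inh|ninh] := pselect (inhabited (assignment U y)); last first.
  exfalso; apply: (aP (PBot x)); exists (PTop _); first exact: conj_nil.
  by move=> a' b; case: ninh.
apply: relative_compactness => delta dG.
have [chi chiP] := eliminate delta.
apply: (chiP U a).2 => //; apply: aP; exists delta => // a' b sb.
by apply: (chiP U a').1; exists b.
Qed.

End Projection.
End Compactness.

(** * Positive formulas on hyperimaginaries *)

Section Translation.
Variables (L : language) (K : Type) (U : structure L) (EE : ptype_family L).
Hypotheses (sL : sufficiently_large L K) (Usat : saturated K U)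
  (EEeq : hyper_equivalences U EE K).

Notation Lheq := (heq_language EE).
Notation Uheq := (heq_structure U EE).

Let snat := small_nat sL.

Definition rep_vars V (x : V -> sort Lheq) : Type := {v : V & rep_var (x v)}.

Definition reps V (x : V -> sort Lheq) : rep_vars x -> sort L :=
  fun v => rep_tuple (projT2 v).

Definition represents_all V (x : V -> sort Lheq) (c : assignment Uheq x)
    (a : assignment U (@reps V x)) : Prop :=
  forall v, @represents L U EE (x v) (c v) (fun r => a (existT _ v r)).

(** A term of a sort of classes is a variable, and is represented by the tuple
    standing for it; a term of a home sort is represented by a term of [L]. *)
Fixpoint term_rep V (x : V -> sort Lheq) s (t : @term Lheq V x s) :
    forall r : rep_var s, term (@reps V x) (@rep_tuple L EE s r) :=
  match t in term _ s
    return forall r : rep_var s, term (@reps V x) (@rep_tuple L EE s r) with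
  | Var v => fun r => Var (@reps V x) (existT _ v r)
  | App f t => fun _ => @App L _ _ f (fun i => term_rep (t i) tt)
  end.

Lemma term_repP V (x : V -> sort Lheq) (c : assignment Uheq x)
    (a : assignment U (@reps V x)) s (t : @term Lheq V x s) :
  represents_all c a ->
  @represents L U EE s (eval c t) (fun r => eval a (term_rep t r)).
Proof.
move=> ca; elim: t => [v|f t IH] /=; first exact: ca.
by congr (fun_int U); apply: functional_extensionality_dep => i; exact: IH.
Qed.

Lemma represented s (c : heq_carrier U s) : exists a, @represents L U EE s c a.
Proof.
case: s c => [s|e] /=; first by move=> c; exists (fun=> c).
by move=> [C [a CE]] /=; exists a; rewrite CE; exact: (EEeq e).2.1.
Qed.

Lemma represents_total s (a : assignment U (@rep_tuple L EE s)) :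
  exists c, @represents L U EE s c a.
Proof.
case: s a => [s|e] a /=; first by exists (a tt).
by exists (exist _ [set b | type_rel a b] (ex_intro _ a erefl)); exact: (EEeq e).2.1.
Qed.

(** The type saying that two tuples represent the same element; for a home sort,
    equality plays the part of [E]. *)
Definition same_rep (s : sort Lheq) :
    set (pformula (ctx_cat (@rep_tuple L EE s) (@rep_tuple L EE s))) :=
  match s with
  | inl s => [set PEq (Var (ctx_cat (@rep_tuple L EE (inl s)) (@rep_tuple L EE (inl s))) (inl tt))
                   (Var (ctx_cat (@rep_tuple L EE (inl s)) (@rep_tuple L EE (inl s))) (inr tt))]
  | inr e => @hset L EE e
  end.

Lemma same_repP s (c : heq_carrier U s) a0 a :
  @represents L U EE s c a0 ->
  represents c a <-> (forall chi, same_rep chi -> sat (assign_cat a0 a) chi).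
Proof.
case: s c a0 a => [s|e] /= c a0 a.
  by move=> <-; split=> [e _ -> /=|/(_ _ erefl) /= ->].
case: c => C [a1 CE]; subst C => /= a10; have [_ [_ [sym trans]]] := EEeq e.
by split=> [/(trans _ _ _ (sym _ _ a10))|/(trans _ _ _ a10)].
Qed.

Lemma represents_inj s (c c' : heq_carrier U s) a :
  @represents L U EE s c a -> @represents L U EE s c' a -> c = c'.
Proof.
case: s c c' a => [s|e] /= c c' a; first by move=> <-.
have [_ [_ [sym trans]]] := EEeq e.
case: c c' => C [a1 CE] [C' [a2 C'E]]; subst C C' => /= a1a a2a.
apply: eq_exist; apply/seteqP; split=> b /= h.
  exact: trans a2a (trans _ _ _ (sym _ _ a1a) h).
exact: trans a1a (trans _ _ _ (sym _ _ a2a) h).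
Qed.

Lemma small_rep_var s : small K [set: @rep_var L EE s].
Proof.
case: s => [s|e] /=; last exact: (EEeq e).1.
by apply: small_embeds snat; exists (fun=> 0) => -[] [].
Qed.

Lemma small_rep_vars_ord n (x : 'I_n -> sort Lheq) : small K [set: rep_vars x].
Proof. exact: small_sigma_ord snat _ _ (fun i => small_rep_var (x i)). Qed.

Lemma small_rep_vars_ext V (x : V -> sort Lheq) s :
  small K [set: rep_vars x] -> small K [set: rep_vars (ctx_ext x s)].
Proof.
move=> sx; apply: small_embeds (small_sum snat sx (small_rep_var s)).
exists (fun p : rep_vars (ctx_ext x s) => match p with existT o r =>
    match o return rep_var (ctx_ext x s o) -> rep_vars x + rep_var s with
    | Some v => fun r => inl (existT _ v r)
    | None => fun r => inr r
    end r end).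
apply: (can_inj (g := fun q => match q with
    | inl p => existT (fun o => rep_var (ctx_ext x s o)) (Some (projT1 p)) (projT2 p)
    | inr r => existT (fun o => rep_var (ctx_ext x s o)) None r
    end)).
by move=> [[v|] r].
Qed.

(** By induction on [phi]. Equality is [same_rep]. A new relation symbol asks for
    other representatives of its arguments, so it is the projection of a type;
    so is a quantified formula, because every tuple represents some element and
    every element is represented. For a disjunction, take all disjunctions of a
    formula of one type with a formula of the other. *)
Lemma translate V (x : V -> sort Lheq) (phi : @pformula Lheq V x) :
  small K [set: rep_vars x] ->
  exists Phi : set (pformula (@reps V x)),
    forall c a, represents_all c a -> (sat c phi <-> forall chi, Phi chi -> sat a chi).
Proof.
elim: phi => {V x} [V x|V x|V x s t u|V x [r|r] t|V x p IHp q IHq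
  |V x p IHp q IHq|V x s p IH] sx.
- by exists set0.
- by exists [set PBot _] => c a ca; split=> [|/(_ _ erefl)].
- pose sigma v : term (@reps V x) (ctx_cat (@rep_tuple L EE s) (@rep_tuple L EE s) v) :=
    match v with inl r => term_rep t r | inr r => term_rep u r end.
  exists (subst sigma @` same_rep (s := s)) => c a ca /=.
  have tP := term_repP t ca; have uP := term_repP u ca.
  have sE : (fun v => eval a (sigma v)) = assign_cat (fun r => eval a (term_rep t r))
      (fun r => eval a (term_rep u r)) by apply: functional_extensionality_dep => -[].
  split=> [tu _ [chi chiS <-]|aP].
    rewrite sat_subst sE; apply: (same_repP _ tP).1 => //.
    by rewrite tu.
  apply: represents_inj uP; apply/(same_repP _ tP) => chi chiS.
  by have := aP _ (imageP _ chiS); rewrite sat_subst sE.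
- exists [set @PRel L _ _ r (fun i => term_rep (t i) tt)] => c a ca.
  have tE i : eval a (term_rep (t i) tt) = eval c (t i) := term_repP (t i) ca.
  have {}tE : (fun i => eval a (term_rep (t i) tt)) = fun i => eval c (t i).
    by apply: functional_extensionality_dep => i; exact: tE.
  by split=> /= [h _ ->|/(_ _ erefl)] /=; rewrite tE.
- (* The tuple [y] holds the other representatives; [sigma i] expresses that its
     [i]-th part represents the [i]-th argument. *)
  pose y := @rep_ctx L EE _ (@nr_dom _ _ r).
  pose xy := ctx_cat (@reps V x) y.
  pose inx v : term xy (@reps V x v) := Var xy (inl v).
  pose iny v : term xy (y v) := Var xy (inr v).
  pose sigma i v : term xy
      (ctx_cat (@rep_tuple L EE (nr_dom i)) (@rep_tuple L EE (nr_dom i)) v) :=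
    match v with
    | inl u => subst_term inx (term_rep (t i) u)
    | inr u => iny (existT _ i u)
    end.
  pose Gamma := [set subst iny (nr_formula r)] `|`
    \bigcup_i (subst (sigma i) @` same_rep (s := nr_dom i)).
  exists (projection U Gamma) => c a ca.
  have sxy : small K [set: rep_vars x + {i : 'I_(nr_arity r) & rep_var (nr_dom i)}].
    exact (small_sum snat sx (small_rep_vars_ord (@nr_dom _ _ r))).
  rewrite -(projectionP sL Usat sxy).
  have sE i b : (fun v => eval (assign_cat a b) (sigma i v)) =
      assign_cat (fun u => eval a (term_rep (t i) u)) (fun u => b (existT _ i u)).
    apply: functional_extensionality_dep => -[u|u] //=.
    by rewrite eval_subst.
  split=> [[b [cb sb]]|[b bG]].
    exists (assign_join b) => _ [->|[i _ [chi chiS <-]]]; rewrite sat_subst //.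
    by rewrite sE; apply: (same_repP _ (term_repP (t i) ca)).1; first exact: cb.
  exists (fun i u => b (existT _ i u)); split=> [i|].
    apply/(same_repP _ (term_repP (t i) ca)) => chi chiS.
    have := bG (subst (sigma i) chi); rewrite sat_subst sE; apply.
    by right; exists i => //; exact: imageP.
  have := bG (subst iny (nr_formula r)); rewrite sat_subst /=.
  have -> : assign_join (fun i u => b (existT _ i u)) = b.
    by apply: functional_extensionality_dep => -[].
  by apply; left.
- have [Phi PhiP] := IHp sx; have [Psi PsiP] := IHq sx.
  exists (Phi `|` Psi) => c a ca /=; rewrite (PhiP c a ca) (PsiP c a ca).
  split=> [[h1 h2] chi [/h1|/h2]//|h].
  by split=> chi ?; apply: h; [left|right].
- have [Phi PhiP] := IHp sx; have [Psi PsiP] := IHq sx.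
  exists [set POr pq.1 pq.2 | pq in Phi `*` Psi] => c a ca /=.
  rewrite (PhiP c a ca) (PsiP c a ca).
  split=> [[h|h] _ [[p' q'] [/= pP qP] <-]|h] /=.
  + by left; exact: h.
  + by right; exact: h.
  + have [|/existsNP[p' /not_implyP[pP np]]] := pselect (forall chi, Phi chi -> sat a chi).
      by left.
    right=> q' qP; have [] // := h (POr p' q') _.
    by exists (p', q').
- have [Phi PhiP] := IH (small_rep_vars_ext s sx).
  pose xy := ctx_cat (@reps V x) (@rep_tuple L EE s).
  pose sigma (v : rep_vars (ctx_ext x s)) : term xy (@reps _ (ctx_ext x s) v) :=
    match v with existT o r =>
      match o return forall r : rep_var (ctx_ext x s o),
          term xy (@rep_tuple L EE (ctx_ext x s o) r) with
      | Some v => fun r => Var xy (inl (existT _ v r))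
      | None => fun r => Var xy (inr r)
      end r
    end.
  exists (projection U (subst sigma @` Phi)) => c a ca.
  have sxs : small K [set: rep_vars x + @rep_var L EE s].
    exact (small_sum snat sx (small_rep_var s)).
  rewrite -(projectionP sL Usat sxs).
  have repE b d : represents d b ->
      represents_all (assign_ext c d) (fun v => eval (assign_cat a b) (sigma v)).
    by move=> db [v|] //=; exact: ca.
  split=> [[d sd]|[b bP]].
    have [b db] := represented d; exists b => _ [chi chiP <-].
    by rewrite sat_subst; apply: (PhiP _ _ (repE _ _ db)).1.
  have [d db] := represents_total b; exists d.
  apply/(PhiP _ _ (repE _ _ db)) => chi chiP.
  by have := bP _ (imageP _ chiP); rewrite sat_subst.
Qed.

End Translation.

(** * Patterns of IP *)

Section Patterns.
Variables (L : language) (V W : Type) (x : V -> sort L) (y : W -> sort L).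
Variables (phi psi : pformula (ctx_cat x y)).

(** What IP requires of the pair of points indexed by [iS]. *)
Definition cell (iS : nat * set nat) : pformula (ctx_cat x y) :=
  if `[< iS.2 iS.1 >] then phi else psi.

Definition pattern (A : structure L) (P : set (nat * set nat)) : Prop :=
  exists (a : nat -> assignment A x) (b : set nat -> assignment A y),
    forall iS, P iS -> sat (assign_cat (a iS.1) (b iS.2)) (cell iS).

Definition finite_pattern (A : structure L) : Prop :=
  forall s : list (nat * set nat), pattern A (fun iS => List.In iS s).

(** The finite pattern along [s] is the conjunction of its cells, with one tuple of
    variables for each [a i] and each [b S]. *)
Lemma finite_pattern_theory (A B : structure L) :
  models A (theory_of B) -> pattern A setT -> finite_pattern B.
Proof.
move=> AB [a [b ab]] s.
pose z := ctx_cat (fun p : nat * V => x p.2) (fun p : set nat * W => y p.2).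
pose sigma (iS : nat * set nat) (v : V + W) : term z (ctx_cat x y v) :=
  match v with inl v => Var z (inl (iS.1, v)) | inr w => Var z (inr (iS.2, w)) end.
have [delta deltaP] : exists delta : pformula z, forall C (e : assignment C z),
    sat e delta <-> forall iS, List.In iS s ->
      sat (assign_cat (fun v => e (inl (iS.1, v))) (fun w => e (inr (iS.2, w)))) (cell iS).
  elim: s => [|iS s [delta deltaP]]; first by exists (PTop z) => C e.
  exists (PAnd (subst (sigma iS) (cell iS)) delta) => C e /=.
  have sE : (fun v => eval e (sigma iS v)) =
      assign_cat (fun v => e (inl (iS.1, v))) (fun w => e (inr (iS.2, w))).
    by apply: functional_extensionality_dep => -[].
  rewrite sat_subst deltaP sE; split=> [[h1 h2] jS [<-|/h2]//|h].
  by split=> [|jS jSs]; apply: h; [left|right].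
pose e : assignment A z := fun v =>
  match v with inl p => a p.1 p.2 | inr p => b p.1 p.2 end.
have [|u /deltaP uP] := theory_of_sat AB (a := e) (phi := delta) _.
  by apply/deltaP => iS _; exact: ab.
by exists (fun i v => u (inl (i, v))), (fun S w => u (inr (S, w))).
Qed.

Section Saturation.
Variables (K : Type) (U : structure L).
Hypotheses (sL : sufficiently_large L K) (Usat : saturated K U).
Hypotheses (sV : small K [set: V]) (sW : small K [set: W]).

(* The context of the whole sequence [a i], and the type [column S] that the
   point [b S] realises over it. *)
Let xs (p : nat * V) := x p.2.
Let xsy := ctx_cat xs y.

Let row i (v : V + W) : term xsy (ctx_cat x y v) :=
  match v with inl v => Var xsy (inl (i, v)) | inr w => Var xsy (inr w) end.

Let column S : set (pformula xsy) := [set subst (row i) (cell (i, S)) | i in setT].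

Let sat_row A (e : assignment A xs) (b : assignment A y) i S :
  sat (assign_cat e b) (subst (row i) (cell (i, S))) =
  sat (assign_cat (fun v => e (i, v)) b) (cell (i, S)).
Proof.
rewrite sat_subst; congr sat.
by apply: functional_extensionality_dep => -[].
Qed.

Let column_finite S delta : conj_of (column S) delta ->
  exists l : list nat, forall (e : assignment U xs) (b : assignment U y),
    (forall i, List.In i l -> sat (assign_cat (fun v => e (i, v)) b) (cell (i, S))) ->
    sat (assign_cat e b) delta.
Proof.
elim=> [|_ d [i _ <-] _ [l lP]]; first by exists [::].
exists (i :: l) => e b h /=; rewrite sat_row; split; first by apply: h; left.
by apply: lP => j jl; apply: h; right.
Qed.

(** A finite part of the union of the projections of the columns involves only
    finitely many cells, so a finite pattern satisfies it. Compactness gives a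
    sequence [e] satisfying all the projections, and by [projectionP] every
    column is realised over [e]. *)
Lemma pattern_saturated : finite_pattern U -> pattern U setT.
Proof.
move=> fin.
have snat := small_nat sL.
have sxs : small K [set: nat * V] := small_prod snat snat sV.
have sxsy : small K [set: (nat * V) + W] := small_sum snat sxs sW.
have [|e eP] := compactness sL Usat (z := xs)
    (Gamma := \bigcup_S projection U (column S)) sxs.
  move=> delta dP.
  have [s sP] : exists s : list (nat * set nat), forall (e : assignment U xs) b,
      (forall iS, List.In iS s ->
        sat (assign_cat (fun v => e (iS.1, v)) (b iS.2)) (cell iS)) -> sat e delta.
    elim: dP => [|chi d [S _ [d' d'S d'chi]] _ [s sP]]; first by exists [::].
    have [l lP] := column_finite d'S.
    exists ([seq (i, S) | i <- l] ++ s) => e b h /=; split.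
      apply: (d'chi e (b S)); apply: lP => i il.
      apply: (h (i, S)); apply/List.in_app_iff; left.
      exact: (List.in_map (fun i => (i, S))).
    by apply: (sP e b) => iS iSs; apply: h; apply/List.in_app_iff; right.
  have [a [b ab]] := fin s; exists (fun p => a p.1 p.2).
  by apply: (sP _ b) => iS; exact: ab.
have bP S : exists b : assignment U y, forall chi, column S chi -> sat (assign_cat e b) chi.
  by apply/(projectionP sL Usat sxsy) => chi chiS; apply: eP; exists S.
exists (fun i v => e (i, v)), (fun S => projT1 (cid (bP S))) => -[i S] _ /=.
rewrite -sat_row; apply: (projT2 (cid (bP S))).
by exists i.
Qed.

End Saturation.
End Patterns.

Lemma conj_of_setU (L : language) V (z : V -> sort L) (G H : set (pformula z)) delta :
  conj_of (G `|` H) delta -> exists g h, [/\ conj_of G g, conj_of H h &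
    forall (A : structure L) (a : assignment A z), sat a g -> sat a h -> sat a delta].
Proof.
elim=> [|phi d GH _ [g [h [Gg Hh ghd]]]].
  by exists (PTop z), (PTop z); split=> //; exact: conj_nil.
case: GH => GH.
  exists (PAnd phi g), h; split=> //; first exact: conj_cons.
  by move=> A a /= [sp sg] sh; split=> //; exact: ghd.
exists g, (PAnd phi h); split=> //; first exact: conj_cons.
by move=> A a /= sg [sp sh]; split=> //; exact: ghd.
Qed.

Section Transfer.
Variables (L : language) (K : Type) (U : structure L) (EE : ptype_family L).
Hypotheses (sL : sufficiently_large L K) (Usat : saturated K U)
  (EEeq : hyper_equivalences U EE K).

Notation Lheq := (heq_language EE).
Notation Uheq := (heq_structure U EE).

Variables (m n : nat) (x : 'I_m -> sort Lheq) (y : 'I_n -> sort Lheq).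

Let X := @reps L EE _ x.
Let Y := @reps L EE _ y.

Let split_reps (v : rep_vars (ctx_cat x y)) :
    term (ctx_cat X Y) (@reps L EE _ (ctx_cat x y) v) :=
  match v with existT w r =>
    match w return forall r : rep_var (ctx_cat x y w),
        term (ctx_cat X Y) (@rep_tuple L EE (ctx_cat x y w) r) with
    | inl i => fun r => Var (ctx_cat X Y) (inl (existT _ i r))
    | inr j => fun r => Var (ctx_cat X Y) (inr (existT _ j r))
    end r
  end.

Lemma small_rep_vars_cat : small K [set: rep_vars (ctx_cat x y)].
Proof.
have snat := small_nat sL.
have sx := small_rep_vars_ord sL EEeq x; have sy := small_rep_vars_ord sL EEeq y.
apply: small_embeds (small_sum snat sx sy).
exists (fun v : rep_vars (ctx_cat x y) => match v with existT w r =>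
    match w return rep_var (ctx_cat x y w) -> rep_vars x + rep_vars y with
    | inl i => fun r => inl (existT _ i r)
    | inr j => fun r => inr (existT _ j r)
    end r end).
apply: (can_inj (g := fun q => match q with
    | inl p => existT (fun o => rep_var (ctx_cat x y o)) (inl (projT1 p)) (projT2 p)
    | inr p => existT (fun o => rep_var (ctx_cat x y o)) (inr (projT1 p)) (projT2 p)
    end)).
by move=> [[i|j] r].
Qed.

Lemma representatives V (z : V -> sort Lheq) (c : assignment Uheq z) :
  exists a, represents_all c a.
Proof.
exists (fun v => projT1 (cid (represented EEeq (c (projT1 v)))) (projT2 v)) => v.
exact: (projT2 (cid (represented EEeq (c v)))).
Qed.

(** If the types of [phi] and [psi] had a common solution, the classes it
    represents would satisfy both formulas. *)
Lemma transfer_pattern (phi psi : @pformula Lheq _ (ctx_cat x y)) :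
  (forall c d, ~ (@sat Lheq Uheq _ _ (assign_cat c d) phi /\ sat (assign_cat c d) psi)) ->
  finite_pattern phi psi Uheq ->
  exists phi0 psi0 : pformula (ctx_cat X Y),
    (forall (a : assignment U X) (b : assignment U Y),
      ~ (sat (assign_cat a b) phi0 /\ sat (assign_cat a b) psi0)) /\
    finite_pattern phi0 psi0 U.
Proof.
move=> disj fin; have sxy := small_rep_vars_cat.
have [Phi PhiP] := translate sL Usat EEeq phi sxy.
have [Psi PsiP] := translate sL Usat EEeq psi sxy.
have [delta [dPP nd]] : exists delta, conj_of (Phi `|` Psi) delta /\
    ~ exists a : assignment U (@reps L EE _ (ctx_cat x y)), sat a delta.
  apply: contrapT => /forallNP nex.
  have [|a aP] := compactness sL Usat (Gamma := Phi `|` Psi) sxy.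
    by move=> delta dP; apply: contrapT => nd; apply: (nex delta).
  pose cP v := represents_total EEeq (fun r => a (existT (fun w => rep_var (ctx_cat x y w)) v r)).
  pose c : assignment Uheq (ctx_cat x y) := fun v => projT1 (cid (cP v)).
  have ca : represents_all c a by move=> v; exact: (projT2 (cid (cP v))).
  have cE : c = assign_cat (fun i => c (inl i)) (fun j => c (inr j)).
    by apply: functional_extensionality_dep => -[].
  apply: (disj (fun i => c (inl i)) (fun j => c (inr j))); rewrite -cE.
  by split; [apply/(PhiP _ _ ca)|apply/(PsiP _ _ ca)] => chi h; apply: aP; [left|right].
have [p [q [Pp Pq pqd]]] := conj_of_setU dPP.
exists (subst split_reps p), (subst split_reps q); split=> [a b|s].
  rewrite !sat_subst => -[sp sq]; apply: nd.
  by exists (fun v => eval (assign_cat a b) (split_reps v)); exact: pqd.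
have [c [d cd]] := fin s.
have [a ca] := choice (fun i => representatives (c i)).
have [b db] := choice (fun S => representatives (d S)).
exists a, b => iS /cd; rewrite /cell.
have cdab : represents_all (assign_cat (c iS.1) (d iS.2))
    (fun v => eval (assign_cat (a iS.1) (b iS.2)) (split_reps v)).
  by move=> [i|j]; [exact: ca|exact: db].
case: asboolP => _ h; rewrite sat_subst.
  by apply: conj_of_sat Pp; apply/(PhiP _ _ cdab).
by apply: conj_of_sat Pq; apply/(PsiP _ _ cdab).
Qed.

End Transfer.

(** * NIP passes to the hyperimaginary extension *)

Theorem proposition6p30 (L : language) (T : theory L) (K : Type)
    (U : structure L) (EE : ptype_family L) :
  positive_theory T ->
  joint_continuation T ->
  sufficiently_large L K ->
  monster K T U ->
  hyper_equivalences U EE K ->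
  NIP T ->
  NIP (heq_theory U EE).
Proof.
move=> _ jcp sL [Upec [_ Usat]] EEeq nip m n x y phi [psi [disj [A [AT [a [b ab]]]]]].
have fin : finite_pattern phi psi (heq_structure U EE).
  apply: finite_pattern_theory AT _; exists a, b => -[i S] _; rewrite /cell /=.
  by case: asboolP => iS; [exact: (ab i S).1|exact: (ab i S).2].
have [|phi0 [psi0 [disj0 fin0]]] := transfer_pattern sL Usat EEeq _ fin.
  by apply: disj.
have [p [f [q [g [phi' [psi' [fwd back]]]]]]] := finite_variables phi0 psi0.
have [a0 [b0 _]] := fin0 [::].
have [u [v uv]] : pattern phi' psi' U setT.
  have snat := small_nat sL.
  have sord k : small K [set: 'I_k] := small_countable snat _.
  apply: (pattern_saturated sL Usat (sord _) (sord _)) => s.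
  have [c [d cd]] := fin0 s.
  exists (fun i j => c i (f j)), (fun S j => d S (g j)) => iS /cd; rewrite /cell.
  by case: asboolP => _; [exact: (fwd _ _ _).1|exact: (fwd _ _ _).2].
apply: (nip _ _ _ _ phi'); exists psi'; split=> [B BT c d [sphi spsi]|].
  have [||w [wphi wpsi]] := joint_sat (phi := PAnd phi' psi') (a := assign_cat c d) jcp Upec BT.
  - constructor; exact: assign_cat (u 0) (v set0).
  - by [].
  have wE : w = assign_cat (fun i => w (inl i)) (fun j => w (inr j)).
    by apply: functional_extensionality_dep => -[].
  rewrite wE in wphi wpsi.
  have [a' [b' sab]] := back _ _ _ (inhabits (a0 0)) (inhabits (b0 set0)) wphi wpsi.
  exact: disj0 sab.
exists U; split; first exact: Upec.1.
exists u, v => i S; have := uv (i, S) I; rewrite /cell /=.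
by case: asboolP => iS h; split.
Qed.
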